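(* Let $g\in\mathcal{F}_0$ and $f\in\mathcal{F}_1$ be such that the Riordan array $(g,f)$ is totally positive. Then for every real $\alpha>0$ the almost-Riordan array $(t\cdot g+\alpha\,|\,g,f)$ is also totally positive.
   Context: For $k\ge 0$, $\mathcal{F}_k$ denotes the set of formal power series $\sum_{n\ge k}a_nt^n$ with real coefficients and $a_k\neq 0$. All matrices are infinite, with rows and columns indexed by $0,1,2,\dots$; writing a matrix as a list $(u_0,u_1,u_2,\dots)$ of formal power series means that the $(n,k)$ entry is the coefficient of $t^n$ in $u_k$. The Riordan array is $(g,f)=(g,gf,gf^2,\dots)$. For a formal power series $d$, the almost-Riordan array is $(d\,|\,g,f)=(d,tg,tgf,tgf^2,\dots)$ (no normalization of $d(0)$, $g(0)$, $f'(0)$ is imposed). An infinite matrix is totally positive (TP) if its minors of all orders are nonnegative. *)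

(* Defs.v *)
From mathcomp Require Import all_boot all_order all_algebra.
From mathcomp Require Import reals.
Set Implicit Arguments.
Unset Strict Implicit.
Unset Printing Implicit Defensive.
Import Order.TTheory GRing.Theory Num.Theory.
Local Open Scope ring_scope.

(* A formal power series is its coefficient sequence: [a n] is [t^n] a. *)
Definition fps (R : Type) : Type := nat -> R.

Section FormalPowerSeries.
Variable R : nzRingType.

Definition fps_const (c : R) : fps R := fun n => if n is 0%N then c else 0.

Definition fps_t : fps R := fun n => (n == 1%N)%:R.

Definition fps_add (a b : fps R) : fps R := fun n => a n + b n.

Definition fps_mul (a b : fps R) : fps R :=
  fun n => \sum_(i < n.+1) a i * b (n - i)%N.

Fixpoint fps_pow (a : fps R) (k : nat) : fps R :=
  if k is k'.+1 then fps_mul a (fps_pow a k') else fps_const 1.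

(* The class F_k of series of order exactly k. *)
Definition fps_order (k : nat) (a : fps R) : Prop :=
  (forall n, (n < k)%N -> a n = 0) /\ a k != 0.

(* Infinite matrices, entry (n, k) being [A n k]. *)
Definition infmx : Type := nat -> nat -> R.

(* The matrix with list of columns (u 0, u 1, u 2, ...). *)
Definition infmx_of_cols (u : nat -> fps R) : infmx := fun n k => u k n.

Definition riordan (g f : fps R) : infmx :=
  infmx_of_cols (fun k => fps_mul g (fps_pow f k)).

(* The almost-Riordan array (d | g, f) = (d, t g, t g f, t g f^2, ...). *)
Definition almost_riordan (d g f : fps R) : infmx :=
  infmx_of_cols (fun k =>
    if k is k'.+1 then fps_mul (fps_mul fps_t g) (fps_pow f k') else d).

Definition infmx_sub (A : infmx) (m : nat) (r c : 'I_m -> nat) : 'M[R]_m :=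
  \matrix_(i, j) A (r i) (c j).

End FormalPowerSeries.

Definition totally_positive (R : realType) (A : infmx R) : Prop :=
  forall (m : nat) (r c : 'I_m -> nat),
    {homo r : i j / (i < j)%N} -> {homo c : i j / (i < j)%N} ->
    0 <= \det (infmx_sub A r c).

(* Main.v *)
(* Write A for the Riordan array (g, f). The first row of the almost-Riordan
   array is (alpha, 0, 0, ...), and the rows below it are those of A with the
   first column repeated. A minor that avoids row 0 is thus a minor of A or has
   two equal columns; a minor through row 0 vanishes or is alpha times a minor
   of A. *)
Require Import Defs.
From mathcomp Require Import all_boot all_order all_algebra.
From mathcomp Require Import reals.
Import Order.TTheory GRing.Theory Num.Theory.
Local Open Scope ring_scope.

Lemma fps_mul_t0 (R : nzRingType) (a : fps R) : fps_mul (fps_t R) a 0%N = 0.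
Proof. by rewrite /fps_mul big_ord1 /fps_t mul0r. Qed.

Lemma fps_mul_tS (R : nzRingType) (a : fps R) (n : nat) :
  fps_mul (fps_t R) a n.+1 = a n.
Proof.
rewrite /fps_mul big_ord_recl /fps_t mul0r add0r big_ord_recl /= mul1r.
rewrite big1 => [|i _]; last by rewrite mul0r.
by rewrite addr0 /bump /= subSS subn0.
Qed.

Lemma fps_mul_tA0 (R : nzRingType) (a b : fps R) :
  fps_mul (fps_mul (fps_t R) a) b 0%N = 0.
Proof. by rewrite {1}/fps_mul big_ord1 fps_mul_t0 mul0r. Qed.

Lemma fps_mul_tAS (R : nzRingType) (a b : fps R) (n : nat) :
  fps_mul (fps_mul (fps_t R) a) b n.+1 = fps_mul a b n.
Proof.
rewrite {1}/fps_mul big_ord_recl fps_mul_t0 mul0r add0r.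
by apply: eq_bigr => i _; rewrite fps_mul_tS.
Qed.

Lemma fps_mul1 (R : nzRingType) (a : fps R) (n : nat) :
  fps_mul a (fps_const 1) n = a n.
Proof.
rewrite /fps_mul big_ord_recr /= subnn /= mulr1 big1 ?add0r // => i _.
(* For [i < n] the index [n - i] is a successor, where [fps_const 1] is 0. *)
by rewrite -(subnSK (ltn_ord i)) mulr0.
Qed.

Section AlmostRiordanEntries.
Variables (R : nzRingType) (g f : fps R) (alpha : R).

Let B :=
  almost_riordan (fps_add (fps_mul (fps_t R) g) (fps_const alpha)) g f.

Lemma almost_riordan_row0 (k : nat) : B 0%N k = if k is 0%N then alpha else 0.
Proof.
case: k => [|k]; rewrite /B /almost_riordan /infmx_of_cols ?fps_mul_tA0 //.
by rewrite /fps_add fps_mul_t0 add0r.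
Qed.

(** Below row 0 the constant [alpha] disappears and the shift by [t] is undone, so columns 0 and 1
    both become [g]; [k.-1] sends both to column 0 of the Riordan array because [0.-1 = 0]. *)
Lemma almost_riordan_rowS (n k : nat) : B n.+1 k = riordan g f n k.-1.
Proof.
case: k => [|k]; rewrite /B /almost_riordan /riordan /infmx_of_cols.
  by rewrite /fps_add fps_mul_tS addr0 /= fps_mul1.
by rewrite fps_mul_tAS.
Qed.

End AlmostRiordanEntries.

Lemma totally_positive_dup_col0 (R : realType) (A : infmx R) :
  totally_positive A -> totally_positive (fun n k => A n k.-1).
Proof.
move=> tpA m r c hr hc.
have -> : infmx_sub (fun n k => A n k.-1) r c =
    infmx_sub A r (fun j => (c j).-1) by apply/matrixP => i j; rewrite !mxE.
case: (boolP [forall i : 'I_m, forall j : 'I_m,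
    (i < j)%N ==> ((c i).-1 < (c j).-1)%N]).
  move=> /forallP hcp; apply: tpA => // i j ij.
  by have /forallP/(_ j)/implyP := hcp i; apply.
rewrite negb_forall => /existsP[i]; rewrite negb_forall => /existsP[j].
rewrite negb_imply -leqNgt => /andP[ij cji].
(* The truncated predecessor is weakly increasing, so a failure of strictness forces two selected
   columns to coincide. *)
have cE : (c i).-1 = (c j).-1.
  by apply/eqP; rewrite eqn_leq cji andbT -!subn1 leq_sub2r // ltnW // hc.
(* [determinant_alternate] asks for equal rows, hence the transpose. *)
rewrite -det_tr (determinant_alternate (i1 := i) (i2 := j)) //.
  by apply: contraTneq ij => ->; rewrite ltnn.
by move=> k; rewrite !mxE cE.
Qed.

Theorem theorem2p4 (R : realType) (g f : fps R)
  (hg : fps_order 0 g) (hf : fps_order 1 f)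
  (hTP : totally_positive (riordan g f))
  (alpha : R) (halpha : 0 < alpha) :
  totally_positive
    (almost_riordan (fps_add (fps_mul (fps_t R) g) (fps_const alpha)) g f).
Proof.
set B := almost_riordan _ _ _.
have B_row0 : forall k, B 0%N k = if k is 0%N then alpha else 0.
  exact: almost_riordan_row0.
have B_rowS : forall n k, B n.+1 k = riordan g f n k.-1.
  exact: almost_riordan_rowS.
clearbody B.
have tpA' := @totally_positive_dup_col0 _ _ hTP.
(* Serves both the minors that avoid row 0 and the cofactor left by the expansion along row 0. *)
have minor_rowS m (r c : 'I_m -> nat) : (forall i, 0 < r i)%N ->
    {homo r : i j / (i < j)%N} -> {homo c : i j / (i < j)%N} ->
    0 <= \det (infmx_sub B r c).
  move=> r_gt0 hr hc.
  have -> : infmx_sub B r c =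
      infmx_sub (fun n k => riordan g f n k.-1) (fun i => (r i).-1) c.
    apply/matrixP => i j.
    by rewrite !mxE -[in LHS](prednK (r_gt0 i)) B_rowS.
  by apply: tpA' => // i j ij; rewrite -ltnS !prednK // hr.
move=> [|m] r c hr hc; first by rewrite det_mx00.
(* As [r] is increasing, only its first value can be 0. *)
have [r0|r0] := posnP (r ord0); last first.
  apply: minor_rowS => // i; case: (unliftP ord0 i) => [j ->|-> //].
  by apply: leq_ltn_trans (hr ord0 (lift ord0 j) _).
(* Selected columns after the first have positive index, where row 0 is zero, so a single term
   survives. *)
rewrite (expand_det_row _ ord0) big_ord_recl big1 => [|j _]; last first.
  rewrite mxE r0 B_row0.
  have := hc ord0 (lift ord0 j) isT.
  by case: (c (lift ord0 j)) => // n _; rewrite mul0r.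
(* The remaining entry is [alpha] if [c ord0] is 0 and 0 otherwise, so it is nonnegative either
   way. *)
rewrite addr0 mxE r0 B_row0 mulr_ge0 //.
  by case: (c _) => // *; exact: ltW.
rewrite /cofactor expr0 mul1r.
have -> : row' ord0 (col' ord0 (infmx_sub B r c)) =
    infmx_sub B (r \o lift ord0) (c \o lift ord0).
  by apply/matrixP => i j; rewrite !mxE.
apply: minor_rowS => [i|i j ij|i j ij] /=.
- by rewrite -r0 hr.
- by apply: hr.
- by apply: hc.
Qed.
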